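(* Let $d\in\mathbb{N}$, let $\alpha=(a_0,\ldots,a_d)\in\mathbb{H}^{d+1}$ and let $\alpha'=(a_1,2a_2,\ldots,ka_k,\ldots,da_d,0)\in\mathbb{H}^{d+1}$. Then the following holds: if $$|Q_\alpha(x)|=\left|\sum_{k=0}^d\left(C^{(1)}_k(x_0)-\overline{x}\,C^{(1)}_{k-1}(x_0)\right)a_k\right|\le M\quad\text{for every } x\in\mathbb{S}^3,$$ then $$|Q_{\alpha'}(x)|=\left|\sum_{k=0}^{d-1}\left(C^{(1)}_k(x_0)-\overline{x}\,C^{(1)}_{k-1}(x_0)\right)(k+1)a_{k+1}\right|\le dM\quad\text{for every } x\in\mathbb{S}^3.$$
   Context: $\mathbb{H}$ is the real algebra of quaternions with basis $1,i,j,k$, Euclidean norm $|\cdot|$ and conjugation $x\mapsto\overline{x}$; $\mathbb{S}^3=\{x\in\mathbb{H}:|x|=1\}$. For $x=x_0+ix_1+jx_2+kx_3\in\mathbb{H}$, $x_0=\operatorname{Re}(x)$ denotes the real part. $C^{(1)}_k$ ($k\ge0$) is the Gegenbauer polynomial of degree $k$ with parameter $1$, i.e. the Chebyshev polynomial of the second kind, and $C^{(1)}_{-1}:=0$. For $\alpha=(a_0,\ldots,a_d)\in\mathbb{H}^{d+1}$, the function $Q_\alpha:\mathbb{S}^3\to\mathbb{H}$ is defined by $Q_\alpha(x):=\sum_{k=0}^d\left(C^{(1)}_k(x_0)-\overline{x}\,C^{(1)}_{k-1}(x_0)\right)a_k$. Here $M$ is a real number. *)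

(* Defs.v *)
From HB Require Import structures.
From mathcomp Require Import all_boot all_order all_algebra.
From mathcomp Require Import reals.
From mathcomp Require Import ring lra.

Set Implicit Arguments.
Unset Strict Implicit.
Unset Printing Implicit Defensive.

Import Order.TTheory GRing.Theory Num.Theory.
Local Open Scope ring_scope.

(* [Quat a b c d] stands for a + i b + j c + k d. *)
Record quaternion (R : Type) := Quat { qRe : R; qI : R; qJ : R; qK : R }.

Definition quat_tuple (R : Type) (x : quaternion R) : R * R * R * R :=
  (qRe x, qI x, qJ x, qK x).

Definition tuple_quat (R : Type) (t : R * R * R * R) : quaternion R :=
  let: (a, b, c, d) := t in Quat a b c d.

Lemma quat_tupleK (R : Type) : cancel (@quat_tuple R) (@tuple_quat R).
Proof. by case. Qed.

HB.instance Definition _ (R : choiceType) :=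
  Choice.copy (quaternion R) (can_type (@quat_tupleK R)).

Section QuaternionAlgebra.
Variable R : rcfType.
Local Notation H := (quaternion R).
Implicit Types (x y z : H) (a b : R).

Definition quat_zero : H := Quat 0 0 0 0.
Definition quat_opp x : H := Quat (- qRe x) (- qI x) (- qJ x) (- qK x).
Definition quat_add x y : H :=
  Quat (qRe x + qRe y) (qI x + qI y) (qJ x + qJ y) (qK x + qK y).

Fact quat_addA : associative quat_add.
Proof. by move=> x y z; rewrite /quat_add /= !addrA. Qed.

Fact quat_addC : commutative quat_add.
Proof. by move=> x y; congr Quat; rewrite addrC. Qed.

Fact quat_add0 : left_id quat_zero quat_add.
Proof. by case=> *; rewrite /quat_add /= !add0r. Qed.

Fact quat_addN : left_inverse quat_zero quat_opp quat_add.
Proof. by move=> x; rewrite /quat_add /= !addNr. Qed.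

HB.instance Definition _ :=
  GRing.isZmodule.Build H quat_addA quat_addC quat_add0 quat_addN.

Definition quat_one : H := Quat 1 0 0 0.
Definition quat_mul x y : H :=
  Quat (qRe x * qRe y - qI x * qI y - qJ x * qJ y - qK x * qK y)
       (qRe x * qI y + qI x * qRe y + qJ x * qK y - qK x * qJ y)
       (qRe x * qJ y - qI x * qK y + qJ x * qRe y + qK x * qI y)
       (qRe x * qK y + qI x * qJ y - qJ x * qI y + qK x * qRe y).

Fact quat_mulA : associative quat_mul.
Proof. by move=> x y z; congr Quat => /=; ring. Qed.

Fact quat_mul1l : left_id quat_one quat_mul.
Proof. by case=> *; congr Quat => /=; ring. Qed.

Fact quat_mul1r : right_id quat_one quat_mul.
Proof. by case=> *; congr Quat => /=; ring. Qed.

Fact quat_mulDl : left_distributive quat_mul +%R.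
Proof. by move=> x y z; congr Quat => /=; ring. Qed.

Fact quat_mulDr : right_distributive quat_mul +%R.
Proof. by move=> x y z; congr Quat => /=; ring. Qed.

Fact quat_one_neq0 : quat_one != 0.
Proof. by apply/eqP => /(congr1 (@qRe R)) /eqP; rewrite /= oner_eq0. Qed.

HB.instance Definition _ := GRing.Zmodule_isNzRing.Build H
  quat_mulA quat_mul1l quat_mul1r quat_mulDl quat_mulDr quat_one_neq0.

Definition quat_scale a x : H := Quat (a * qRe x) (a * qI x) (a * qJ x) (a * qK x).

Fact quat_scaleA a b x : quat_scale a (quat_scale b x) = quat_scale (a * b) x.
Proof. by congr Quat => /=; ring. Qed.

Fact quat_scale1 : left_id 1 quat_scale.
Proof. by case=> *; congr Quat => /=; ring. Qed.

Fact quat_scaleDr : right_distributive quat_scale +%R.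
Proof. by move=> a x y; congr Quat => /=; ring. Qed.

Fact quat_scaleDl x : {morph quat_scale^~ x : a b / a + b}.
Proof. by move=> a b; congr Quat => /=; ring. Qed.

HB.instance Definition _ := GRing.Zmodule_isLmodule.Build R H
  quat_scaleA quat_scale1 quat_scaleDr quat_scaleDl.

Fact quat_scaleAl a x y : a *: (x * y) = (a *: x) * y.
Proof. by congr Quat => /=; ring. Qed.

HB.instance Definition _ := GRing.Lmodule_isLalgebra.Build R H quat_scaleAl.

Fact quat_scaleAr a x y : a *: (x * y) = x * (a *: y).
Proof. by congr Quat => /=; ring. Qed.

HB.instance Definition _ := GRing.Lalgebra_isAlgebra.Build R H quat_scaleAr.

Definition qconj x : H := Quat (qRe x) (- qI x) (- qJ x) (- qK x).

Definition quat_sqnorm x : R := qRe x ^+ 2 + qI x ^+ 2 + qJ x ^+ 2 + qK x ^+ 2.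

Definition quat_norm x : R := Num.sqrt (quat_sqnorm x).

Fact quat_sqnorm_ge0 x : 0 <= quat_sqnorm x.
Proof. by rewrite /quat_sqnorm !addr_ge0 ?sqr_ge0. Qed.

Fact quat_normD x y : quat_norm (x + y) <= quat_norm x + quat_norm y.
Proof.
pose dot := qRe x * qRe y + qI x * qI y + qJ x * qJ y + qK x * qK y.
have dotP : dot <= quat_norm x * quat_norm y.
  rewrite /quat_norm -sqrtrM ?quat_sqnorm_ge0 // (le_trans (ler_norm _)) //.
  rewrite -sqrtr_sqr ler_wsqrtr // -subr_ge0.
  have -> : quat_sqnorm x * quat_sqnorm y - dot ^+ 2 =
      (qRe x * qI y - qI x * qRe y) ^+ 2 + (qRe x * qJ y - qJ x * qRe y) ^+ 2
    + (qRe x * qK y - qK x * qRe y) ^+ 2 + (qI x * qJ y - qJ x * qI y) ^+ 2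
    + (qI x * qK y - qK x * qI y) ^+ 2 + (qJ x * qK y - qK x * qJ y) ^+ 2.
    by rewrite /quat_sqnorm /dot; ring.
  by rewrite !addr_ge0 ?sqr_ge0.
have nn_ge0 : 0 <= quat_norm x + quat_norm y by rewrite addr_ge0 ?sqrtr_ge0.
rewrite -(ger0_norm nn_ge0) -sqrtr_sqr ler_wsqrtr // sqrrD.
rewrite !sqr_sqrtr ?quat_sqnorm_ge0 //.
have -> : quat_sqnorm (x + y) = quat_sqnorm x + dot *+ 2 + quat_sqnorm y.
  by rewrite /quat_sqnorm /dot /=; ring.
by rewrite lerD2r lerD2l lerMn2r dotP orbT.
Qed.

Fact quat_norm0_eq0 x : quat_norm x = 0 -> x = 0.
Proof.
move=> /eqP; rewrite sqrtr_eq0 => x0.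
have {x0} : quat_sqnorm x == 0 by rewrite eq_le x0 quat_sqnorm_ge0.
rewrite /quat_sqnorm !paddr_eq0 ?addr_ge0 ?sqr_ge0 // !sqrf_eq0.
by case: x => a b c d /= /andP[/andP[/andP[/eqP-> /eqP->] /eqP->] /eqP->].
Qed.

Fact quat_normMn x n : quat_norm (x *+ n) = quat_norm x *+ n.
Proof.
have -> : x *+ n = n%:R *: x by rewrite scaler_nat.
have -> : quat_norm (n%:R *: x) = Num.sqrt (n%:R ^+ 2 * quat_sqnorm x).
  by congr Num.sqrt; rewrite /quat_sqnorm /=; ring.
by rewrite sqrtrM ?sqr_ge0 // sqrtr_sqr normr_nat mulr_natl.
Qed.

Fact quat_normN x : quat_norm (- x) = quat_norm x.
Proof. by congr Num.sqrt; rewrite /quat_sqnorm /= !sqrrN. Qed.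

HB.instance Definition _ := Num.Zmodule_isNormed.Build R H
  quat_normD quat_norm0_eq0 quat_normMn quat_normN.

Definition S3 : {pred H} := [pred x : H | `|x| == 1].

End QuaternionAlgebra.

Section Gegenbauer.
Variable R : rcfType.

(* n C_n = 2 (n + lam - 1) X C_(n-1) - (n + 2 lam - 2) C_(n-2) *)
Fixpoint gegenbauer_nat (lam : R) (n : nat) : {poly R} :=
  match n with
  | 0 => 1
  | n1.+1 =>
    match n1 with
    | 0 => (2 * lam) *: 'X
    | n2.+1 => n%:R^-1 *:
        ((2 * (n%:R + lam - 1)) *: ('X * gegenbauer_nat lam n1)
         - (n%:R + 2 * lam - 2) *: gegenbauer_nat lam n2)
    end
  end.

(* Extended by zero to negative degrees. *)
Definition gegenbauer (lam : R) (k : int) : {poly R} :=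
  if k is Posz n then gegenbauer_nat lam n else 0.

(* For lam = 1 these are the Chebyshev polynomials of the second kind. *)
Lemma gegenbauer1_rec (n : nat) :
  gegenbauer_nat 1 n.+2 =
    2 *: ('X * gegenbauer_nat (1 : R) n.+1) - gegenbauer_nat 1 n.
Proof.
have nz : (n.+2%:R : R) != 0 by rewrite pnatr_eq0.
rewrite [LHS]/= -/(gegenbauer_nat _ n.+1) addrK mulr1 addrK.
by rewrite scalerBr !scalerA mulrCA mulVf // mulr1 scale1r.
Qed.

End Gegenbauer.

Section Qalpha.
Variable R : rcfType.

(* C^(1)_k(x_0) - conj(x) C^(1)_(k-1)(x_0) *)
Definition Qterm (k : nat) (x : quaternion R) : quaternion R :=
  (gegenbauer 1 k%:Z).[qRe x]%:A
  - qconj x * (gegenbauer 1 (k%:Z - 1)).[qRe x]%:A.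

Definition Q (d : nat) (alpha : 'I_d.+1 -> quaternion R) (x : quaternion R)
    : quaternion R :=
  \sum_(k < d.+1) Qterm k x * alpha k.

(* The k-th entry is (k+1) a_(k+1) for k < d, and 0 for k = d, which is the
   case where [insub] fails. *)
Definition alpha_prime (d : nat) (alpha : 'I_d.+1 -> quaternion R)
    : 'I_d.+1 -> quaternion R :=
  fun k => if insub k.+1 is Some j then alpha j *+ k.+1 else 0.

End Qalpha.

(* Main.v *)
Require Import Defs.
From mathcomp Require Import all_boot all_order all_algebra.
From mathcomp Require Import reals ring zify.
From mathcomp Require Import cyclic separable cyclotomic complex.

Set Implicit Arguments.
Unset Strict Implicit.
Unset Printing Implicit Defensive.

Import Order.TTheory GRing.Theory Num.Theory.
Local Open Scope ring_scope.

(** On the unit sphere the conjugate of x is its inverse, so the Chebyshev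
    recurrence turns C_k(x_0) - conj(x) C_(k-1)(x_0) into the power x^k
    (QtermX).  Thus Q_alpha(x) is the polynomial sum_k x^k a_k with coefficients
    on the right, x Q_alpha'(x) is sum_k k x^k a_k, and the claim is a
    quaternionic Bernstein inequality.

    The proof is that of M. Riesz for trigonometric polynomials.  There are
    real weights c_j and 2d-th roots of unity w_j in C with
      sum_j c_j w_j^k = k  for 0 <= k <= d,   and   sum_j |c_j| = d
    (riesz_weights).  The function |k| on Z/2d has positive mean d/2, and all
    its other Fourier coefficients are nonpositive, because d - |k| is the
    correlation of the indicator function of [0, d) with itself and so has
    coefficients |sum_(m<d) w_j^m|^2 / 2d.  Evaluating at k = 0 shows that the
    nonpositive coefficients add up to -d/2, which gives the total mass d.

    Each x in H lies in a copy R + R u of the complex numbers, where u^2 = -1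
    (slice_cover); transporting the weights there, with y_j the product of x
    and the image of w_j, gives
      x Q_alpha'(x) = sum_j c_j Q_alpha(y_j),   y_j in S^3
    (riesz_interpolation).  The coefficients a_k stay on the right throughout,
    so that their noncommutativity is harmless, and the triangle inequality
    ends the proof. *)

(** * Roots of unity and interpolation weights *)

Lemma prim_root_exists (C : numClosedFieldType) (n : nat) :
  (0 < n)%N -> exists z : C, n.-primitive_root z.
Proof.
move=> n_gt0; pose p : {poly C} := 'X^n - 1.
have [r Dp] := closed_field_poly_normal p.
rewrite (monicP _) ?monicXnsubC // scale1r in Dp.
have rn1 : all n.-unity_root r by apply/allP=> z; rewrite -root_prod_XsubC -Dp.
have sz_r : (n < (size r).+1)%N.
  by rewrite -(size_prod_XsubC r id) -Dp size_XnsubC.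
have r_uniq : uniq r.
  rewrite -separable_prod_XsubC -Dp separable_Xn_sub_1 // pnatr_eq0.
  by rewrite -lt0n.
by have /hasP[z] := has_prim_root n_gt0 rn1 r_uniq sz_r; exists z.
Qed.

Lemma sum_prim_root (F : fieldType) (n : nat) (z : F) (e : nat) :
  n.-primitive_root z ->
  \sum_(j < n) (z ^+ j) ^+ e = if (n %| e)%N then n%:R else 0.
Proof.
move=> z_prim.
rewrite (eq_bigr (fun j : 'I_n => (z ^+ e) ^+ j)) => [|j _]; last exact: exprAC.
have -> : (n %| e)%N = (z ^+ e == 1) by rewrite (prim_order_dvd z_prim).
have [ze1|ze_neq1] := eqVneq (z ^+ e) 1.
  by under eq_bigr do rewrite ze1 expr1n; rewrite sumr_const card_ord.
have /eqP := subrX1 (z ^+ e) n.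
rewrite exprAC (prim_expr_order z_prim) expr1n subrr eq_sym mulf_eq0.
by rewrite subr_eq0 (negPf ze_neq1) => /eqP.
Qed.

(** The autocorrelation of the indicator function of [0, d) is the tent
    d - k; for k > d both sides vanish, by truncated subtraction. *)
Lemma count_shifted_pairs (S : nzSemiRingType) (d k : nat) :
  \sum_(m < d) \sum_(l < d) ((m + k)%N == l)%:R = (d - k)%:R :> S.
Proof.
have inner (m : 'I_d) :
    \sum_(l < d) ((m + k)%N == l)%:R = (m < d - k)%:R :> S.
  have [lt_mk|le_mk] := ltnP m (d - k).
    have mk : (m + k < d)%N by lia.
    rewrite (bigD1 (Ordinal mk)) //= eqxx big1 ?addr0 // => l.
    by rewrite eq_sym -val_eqE => /negPf /= ->.
  by rewrite big1 // => l _; case: eqP => // ml; have := ltn_ord l; lia.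
under eq_bigr do rewrite inner.
rewrite -(big_mkord predT (fun m => (m < d - k)%:R)) -natr_sum.
rewrite (big_cat_nat (leq0n _) (leq_subr k d)) /=.
rewrite [X in (_ + X)%N]big1_seq => [|m]; last first.
  by rewrite mem_index_iota => /andP[_ /andP[le_m _]]; rewrite ltnNge le_m.
rewrite addn0 big_nat (eq_bigr (fun=> 1%N)) => [|m /andP[_ ->] //].
by rewrite -big_nat sum_nat_const_nat subn0 muln1.
Qed.

(** Expanding the square turns the left side into a sum over pairs (m, l) of
    power sums with exponent m + k - l.  Since k <= d this exponent lies
    strictly between -d and 2d, so orthogonality modulo 2d keeps exactly the
    pairs with m + k = l: there is no aliasing. *)
Lemma fejer_sum (C : numClosedFieldType) (d k : nat) (z : C) :
  (k <= d)%N -> (d.*2).-primitive_root z ->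
  \sum_(j < d.*2) `|\sum_(m < d) (z ^+ j) ^+ m| ^+ 2 * (z ^+ j) ^+ k =
    (d.*2)%:R * (d - k)%:R.
Proof.
move=> le_kd z_prim; have n_gt0 := prim_order_gt0 z_prim.
have term (j : 'I_(d.*2)) : 
    `|\sum_(m < d) (z ^+ j) ^+ m| ^+ 2 * (z ^+ j) ^+ k =
    \sum_(m < d) \sum_(l < d) (z ^+ j) ^+ (m + k + (d.*2 - l)).
  set w := z ^+ j.
  have wn : w ^+ d.*2 = 1 by rewrite /w exprAC (prim_expr_order z_prim) expr1n.
  have w_neq0 : w != 0.
    by have := expf_eq0 w d.*2; rewrite wn oner_eq0 n_gt0 => /= <-.
  have w_norm : `|w| = 1.
    by apply/eqP; rewrite -(pexpr_eq1 n_gt0) // -normrX wn normr1.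
  have w_conj : w^* = w^-1 by rewrite invC_norm w_norm expr1n invr1 mul1r.
  (* The inverse of w ^+ l is w ^+ (2d - l), which keeps exponents natural. *)
  rewrite normCK rmorph_sum mulr_suml mulr_suml; apply: eq_bigr => m _.
  rewrite mulr_sumr mulr_suml; apply: eq_bigr => l _.
  rewrite rmorphXn /= w_conj !exprD exprB ?wn ?unitfE//; last first.
    by have := ltn_ord l; lia.
  by rewrite mul1r exprVn mulrAC.
under eq_bigr do rewrite term.
rewrite exchange_big /= -count_shifted_pairs mulr_sumr.
apply: eq_bigr => m _; rewrite exchange_big mulr_sumr.
apply: eq_bigr => l _; rewrite (sum_prim_root _ z_prim).
have -> : (d.*2 %| m + k + (d.*2 - l))%N = ((m + k)%N == l).
  have m_lt := ltn_ord m; have l_lt := ltn_ord l.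
  apply/idP/eqP => [/dvdnP[q]|eq_mkl]; last by rewrite eq_mkl subnKC //; lia.
  case: q => [|[|q]]; rewrite ?mulSn; nia.
by case: eqP; rewrite ?mulr1 ?mulr0.
Qed.

(** The weights are the Fourier coefficients of |k| = d - (d - |k|) on Z/2d:
    a mass d at the root 1 minus the Fejer weights mu.  The mass left at 1 is
    d/2, and it is the only positive weight; since all weights sum to 0 (the
    moment k = 0), their absolute values sum to twice d/2. *)
Lemma riesz_weights_closed (C : numClosedFieldType) (d : nat) :
  exists (c w : 'I_(d.*2) -> C),
  [/\ forall j, c j \is Num.real, forall j, w j ^+ d.*2 = 1,
      \sum_j `|c j| = d%:R &
      forall k, (k <= d)%N -> \sum_j c j * w j ^+ k = k%:R].
Proof.
case: d => [|d'].
  by exists (fun=> 0), (fun=> 0); split=> [[]//|[]//||[|k]//]; rewrite big_ord0.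
set d := d'.+1; have n_gt0 : (0 < d.*2)%N by [].
have [z z_prim] := prim_root_exists C n_gt0.
have d2_neq0 : (d.*2)%:R != 0 :> C by rewrite pnatr_eq0.
pose j0 : 'I_(d.*2) := Ordinal n_gt0.
pose mu j : C := `|\sum_(m < d) (z ^+ j) ^+ m| ^+ 2 / (d.*2)%:R.
pose c (j : 'I_(d.*2)) : C := d%:R *+ (j == j0) - mu j.
have mu_ge0 j : 0 <= mu j by rewrite divr_ge0 ?exprn_ge0.
have moments k : (k <= d)%N -> \sum_j c j * (z ^+ j) ^+ k = k%:R.
  move=> le_kd; under eq_bigr do rewrite mulrBl.
  rewrite sumrB (bigD1 j0) //= expr0 expr1n mulr1.
  rewrite big1 => [|j /negPf->]; last by rewrite mul0r.
  under [X in _ - X]eq_bigr do rewrite mulrAC.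
  rewrite -mulr_suml fejer_sum // mulrAC divff // mul1r natrB // addr0.
  by rewrite opprB addrC subrK.
have mu0 : mu j0 = d%:R / 2.
  rewrite /mu; under eq_bigr do rewrite expr0 expr1n.
  rewrite sumr_const card_ord ger0_norm // -mul2n natrM; field.
  by rewrite pnatr_eq0.
exists c, (fun j => z ^+ j); split=> // [j|j|].
- by rewrite rpredB ?rpredMn ?rpred_nat ?ger0_real.
- by rewrite exprAC (prim_expr_order z_prim) expr1n.
have sum_c : \sum_j c j = 0.
  by rewrite -[RHS](moments 0%N) //; apply: eq_bigr => j _; rewrite mulr1.
have c0 : c j0 = d%:R / 2 by rewrite /c eqxx mulr1n mu0; field.
have -> : \sum_j `|c j| = \sum_j (c j0 *+ 2 *+ (j == j0) - c j).
  apply: eq_bigr => j _; have [->|j_neq0] := eqVneq j j0.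
    by rewrite ger0_norm ?mulr2n ?addrK // c0 divr_ge0.
  by rewrite /c (negPf j_neq0) !mulr0n !sub0r normrN opprK ger0_norm.
rewrite sumrB sum_c subr0 (bigD1 j0) //= big1 => [|j /negPf-> //].
by rewrite addr0 c0; field.
Qed.

(** Real weights are needed, not just complex numbers of real type, in order to
    let them act on the quaternions. *)
Lemma riesz_weights (R : rcfType) (d : nat) :
  exists (c : 'I_(d.*2) -> R) (w : 'I_(d.*2) -> complex R),
  [/\ forall j, w j ^+ d.*2 = 1, \sum_j `|c j| = d%:R &
      forall k, (k <= d)%N -> \sum_j real_complex R (c j) * w j ^+ k = k%:R].
Proof.
have [c [w [c_real w_root sum_c moments]]] :=
  riesz_weights_closed (complex R) d.
exists (fun j => complex.Re (c j)), w; split=> // [|k le_kd].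
  apply: (@complexI R); rewrite rmorph_sum rmorph_nat -sum_c.
  apply: eq_bigr => j _; rewrite -[in RHS](RRe_real (c_real j)) normc_def /=.
  by rewrite expr0n addr0 sqrtr_sqr.
rewrite -moments //; apply: eq_bigr => j _.
by rewrite (RRe_real (c_real j)).
Qed.

(** * The quaternion norm and the terms of Q as powers *)

Section QuaternionNorm.
Variable R : rcfType.
Implicit Types x y : quaternion R.

Lemma quat_normM x y : `|x * y| = `|x| * `|y|.
Proof.
rewrite /Num.norm /= /quat_norm -sqrtrM ?quat_sqnorm_ge0 //; congr Num.sqrt.
by rewrite /quat_sqnorm /=; ring.
Qed.

Lemma quat_normZ (a : R) x : `|a *: x| = `|a| * `|x|.
Proof.
rewrite {1 3}/Num.norm /= /quat_norm -sqrtr_sqr -sqrtrM ?sqr_ge0 //.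
by congr Num.sqrt; rewrite /quat_sqnorm /=; ring.
Qed.

Lemma quat_norm1 : `|1 : quaternion R| = 1.
Proof.
by rewrite /Num.norm /= /quat_norm /quat_sqnorm /= expr1n expr0n !addr0 sqrtr1.
Qed.

Lemma quat_normX x n : `|x ^+ n| = `|x| ^+ n.
Proof. by elim: n => [|n IH]; rewrite ?quat_norm1 // !exprS quat_normM IH. Qed.

Lemma S3_sqnorm x : x \in @S3 R -> quat_sqnorm x = 1.
Proof.
rewrite inE /Num.norm /= /quat_norm => /eqP x1.
by rewrite -[LHS]sqr_sqrtr ?quat_sqnorm_ge0 // x1 expr1n.
Qed.

(** Writing x = 2 x_0 - conj(x) and x conj(x) = 1, multiplication by x on the
    left takes U_k - conj(x) U_(k-1) to (2 x_0 U_k - U_(k-1)) - conj(x) U_k,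
    which is the next term by the Chebyshev recurrence. *)
Lemma QtermX x k : x \in @S3 R -> Qterm k x = x ^+ k.
Proof.
move=> /S3_sqnorm x1.
have xE : x = (2 * qRe x)%:A - qconj x.
  by case: x {x1} => a b c e; congr Quat => /=; ring.
have x_conj : x * qconj x = 1.
  by rewrite -[RHS]scale1r -x1; congr Quat; rewrite /quat_sqnorm /=; ring.
have sub1 (n : nat) : n.+1%:Z - 1 = n%:Z by rewrite intS addrC addKr.
have QtermS n : Qterm n.+1 x =
    (gegenbauer_nat 1 n.+1).[qRe x]%:A
      - (gegenbauer_nat 1 n).[qRe x] *: qconj x.
  by rewrite /Qterm sub1 -scalerAr mulr1.
(* At k = 0 the second polynomial has degree -1 and vanishes, so the
   recurrence only starts at k = 1. *)
case: k => [|k].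
  by rewrite /Qterm /= !hornerE scale0r mulr0 subr0 scale1r.
elim: k => [|k IH].
  by rewrite QtermS /= mulr1 !hornerE scale1r -xE.
rewrite exprS -IH !QtermS gegenbauer1_rec !hornerE mulrBr -!scalerAr.
rewrite x_conj mulr1.
rewrite [X in _ = _ *: X - _]xE scalerBr scalerA scalerBl addrAC.
by rewrite [_ * (2 * _)]mulrC.
Qed.

End QuaternionNorm.

(** * Complex slices of the quaternions *)

Section Slice.
Variables (R : rcfType) (A : algType R) (u : A).
Implicit Types y z : complex R.

(** When u squares to -1 this is the embedding of the complex numbers that
    sends the imaginary unit to u. *)
Definition slice y : A := (complex.Re y)%:A + complex.Im y *: u.

Lemma slice_real (a : R) : slice (real_complex R a) = a%:A.
Proof. by rewrite /slice /= scale0r addr0. Qed.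

Lemma slice_nat n : slice n%:R = n%:R.
Proof. by rewrite -(rmorph_nat (real_complex R)) slice_real scaler_nat. Qed.

Lemma slice0 : slice 0 = 0.
Proof. by rewrite (slice_real 0) scale0r. Qed.

Lemma sliceD y z : slice (y + z) = slice y + slice z.
Proof. by case: y z => [a b] [c e]; rewrite /slice /= !scalerDl addrACA. Qed.

Lemma slice_sum (I : Type) (r : seq I) (P : pred I) (F : I -> complex R) :
  slice (\sum_(i <- r | P i) F i) = \sum_(i <- r | P i) slice (F i).
Proof. exact: (big_morph _ sliceD slice0). Qed.

Hypothesis u_sqr : u * u = -1.

Lemma sliceM y z : slice (y * z) = slice y * slice z.
Proof.
case: y z => [a b] [c e]; rewrite /slice /= mulrDl !mulrDr.
rewrite -!scalerAl -!scalerAr u_sqr !mul1r !mulr1 !scalerA scalerN.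
rewrite scalerBl scalerDl -!addrA; congr (_ + _).
by rewrite addrC -addrA.
Qed.

Lemma sliceX y n : slice (y ^+ n) = slice y ^+ n.
Proof.
elim: n => [|n IH]; first by rewrite !expr0 (slice_real 1) scale1r.
by rewrite !exprS sliceM IH.
Qed.

End Slice.

(** The unit u is the normalized imaginary part of x; when x is real any
    imaginary unit will do. *)
Lemma slice_cover (R : rcfType) (x : quaternion R) :
  exists2 u : quaternion R, u * u = -1 & exists y, x = slice u y.
Proof.
case: x => a b c e; pose s := Num.sqrt (b ^+ 2 + c ^+ 2 + e ^+ 2).
have t_ge0 : 0 <= b ^+ 2 + c ^+ 2 + e ^+ 2 by rewrite !addr_ge0 ?sqr_ge0.
have sE : s ^+ 2 = b ^+ 2 + c ^+ 2 + e ^+ 2 by rewrite sqr_sqrtr.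
have [s0|s_neq0] := eqVneq s 0.
  move: sE; rewrite s0 expr0n /= => /esym/eqP.
  rewrite !paddr_eq0 ?addr_ge0 ?sqr_ge0 // !sqrf_eq0.
  move=> /andP[/andP[/eqP-> /eqP->] /eqP->].
  exists (Quat 0 1 0 0); first by congr Quat => /=; ring.
  by exists (real_complex R a); rewrite slice_real; congr Quat => /=; ring.
exists (Quat 0 (b / s) (c / s) (e / s)).
  congr Quat => /=; try ring.
  have -> : -1 = - (s ^+ 2 / s ^+ 2) by rewrite divff // expf_neq0.
  by rewrite {1}sE; field.
by exists (Complex a s); congr Quat => /=; field.
Qed.

(** * Interpolation of the derivative *)

Lemma Q_powers (R : rcfType) (d : nat) (alpha : 'I_d.+1 -> quaternion R) x :
  x \in @S3 R -> Q alpha x = \sum_(k < d.+1) x ^+ k * alpha k.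
Proof. by move=> x1; apply: eq_bigr => k _; rewrite QtermX. Qed.

Lemma Q_alpha_prime (R : rcfType) (d : nat) (alpha : 'I_d.+1 -> quaternion R)
    x :
  Q (alpha_prime alpha) x =
    \sum_(k < d) Qterm k x * (alpha (lift ord0 k) *+ k.+1).
Proof.
rewrite /Q big_ord_recr /= {2}/alpha_prime insubF ?ltnn // mulr0 addr0.
apply: eq_bigr => k _; congr (_ * _); rewrite /alpha_prime.
case: insubP => [j _ jE|]; last by rewrite /= ltnS ltn_ord.
by congr (alpha _ *+ _); apply: val_inj.
Qed.

(** A form of M. Riesz's interpolation formula: the weights do not depend on x
    or alpha, and the nodes y_j are x multiplied by roots of unity of its own
    slice, which commute with x. *)
Lemma riesz_interpolation (R : rcfType) (d : nat)
    (alpha : 'I_d.+1 -> quaternion R) x : x \in @S3 R ->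
  exists (c : 'I_(d.*2) -> R) (y : 'I_(d.*2) -> quaternion R),
  [/\ forall j, y j \in @S3 R, \sum_j `|c j| = d%:R &
      x * Q (alpha_prime alpha) x = \sum_j c j *: Q alpha (y j)].
Proof.
move=> x1; have [u u_sqr [z xz]] := slice_cover x.
have [c [w [w_root sum_c moments]]] := riesz_weights R d.
have yS3 j : slice u (w j * z) \in @S3 R.
  have n_gt0 : (0 < d.*2)%N by apply: leq_ltn_trans (ltn_ord j).
  rewrite inE sliceM // -xz quat_normM (eqP x1) mulr1.
  rewrite -(pexpr_eq1 n_gt0) // -quat_normX -sliceX // w_root.
  by rewrite (slice_real _ 1) scale1r quat_norm1.
exists c, (fun j => slice u (w j * z)); split=> //.
have moment k : (k <= d)%N ->
    \sum_j c j *: slice u (w j * z) ^+ k = x ^+ k *+ k.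
  move=> le_kd.
  rewrite -mulr_natl -(slice_nat u) -moments // slice_sum mulr_suml.
  apply: eq_bigr => j _; rewrite -sliceX // exprMn !sliceM // slice_real.
  by rewrite mulr_algl -scalerAl [slice u (z ^+ k)]sliceX // -xz.
under [RHS]eq_bigr do rewrite Q_powers // scaler_sumr.
rewrite exchange_big /=.
under [RHS]eq_bigr => k _.
  under eq_bigr do rewrite scalerAl.
  rewrite -mulr_suml (moment k (ltn_ord k)); over.
rewrite big_ord_recl mulr0n mul0r add0r Q_alpha_prime mulr_sumr.
by apply: eq_bigr => k _; rewrite QtermX // mulrA -exprS mulrnAr mulrnAl.
Qed.

Theorem corollary7 (R : realType) (d : nat) (alpha : 'I_d.+1 -> quaternion R)
    (M : R) :
  (forall x : quaternion R, x \in @S3 R -> `|Q alpha x| <= M) ->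
  forall x : quaternion R, x \in @S3 R ->
    `|Q (alpha_prime alpha) x| =
      `|\sum_(k < d) Qterm k x * (alpha (lift ord0 k) *+ k.+1)|
    /\ `|Q (alpha_prime alpha) x| <= d%:R * M.
Proof.
move=> Q_le_M x x1; split; first by rewrite Q_alpha_prime.
have [c [y [y1 sum_c xQ]]] := riesz_interpolation alpha x1.
have -> : `|Q (alpha_prime alpha) x| = `|x * Q (alpha_prime alpha) x|.
  by rewrite quat_normM (eqP x1) mul1r.
rewrite xQ -sum_c mulr_suml.
apply: (le_trans (ler_norm_sum _ _ _)); apply: ler_sum => j _.
by rewrite quat_normZ ler_wpM2l ?Q_le_M.
Qed.
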